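(* Every pawful graph is diagonal.
   Context: All graphs are finite, simple, undirected and connected; $d$ denotes the shortest-path distance. A pawful graph is a connected graph $G$ of diameter at most $2$ such that for any three vertices $u,v,w$ with $d(u,v)=d(v,w)=2$ and $d(u,w)=1$ there exists a vertex $x$ with $d(x,u)=d(x,v)=d(x,w)=1$. For vertices $x_0,\dots,x_k$ put $\ell(x_0,\dots,x_k)=\sum_{i=0}^{k-1}d(x_i,x_{i+1})$. The magnitude chain complex: $\mathrm{MC}_{k,l}(G)$ is the free abelian group on $I_{k,l}(G)=\{(x_0,\dots,x_k)\in V(G)^{k+1}: x_i\neq x_{i+1}\ \forall i,\ \ell(x_0,\dots,x_k)=l\}$, with differential $\partial=\sum_{i=1}^{k-1}(-1)^i\partial_i:\mathrm{MC}_{k,l}\to\mathrm{MC}_{k-1,l}$, where $\partial_i(x_0,\dots,x_k)=(x_0,\dots,\hat x_i,\dots,x_k)$ if deleting $x_i$ does not change $\ell$, and $0$ otherwise. Magnitude homology: $\mathrm{MH}_{k,l}(G)=H_k(\mathrm{MC}_{*,l}(G))$. $G$ is diagonal if $\mathrm{MH}_{k,l}(G)=0$ whenever $k\ne l$. *)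

(* Defs.v *)
From HB Require Import structures.
From mathcomp Require Import all_boot all_order all_algebra.
Set Implicit Arguments. Unset Strict Implicit. Unset Printing Implicit Defensive.
Import Order.TTheory GRing.Theory Num.Theory.

Section Graphs.
Variables (T : finType) (e : rel T).

Definition simple_connected_graph : Prop :=
  symmetric e /\ irreflexive e /\ (forall x y, connect e x y).

Definition walk_of_len (x y : T) (k : nat) : bool :=
  [exists p : k.-tuple T, path e x p && (last x p == y)].

(* shortest-path distance: least k with a walk of length k from x to y
   (a connected graph has all distances < #|T|) *)
Definition dist (x y : T) : nat := find (walk_of_len x y) (iota 0 #|T|).

Definition pawful : Prop :=
  simple_connected_graph /\
  (forall x y, dist x y <= 2) /\
  (forall u v w, dist u v = 2 -> dist v w = 2 -> dist u w = 1 ->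
     exists x, [/\ dist x u = 1, dist x v = 1 & dist x w = 1]).

Fixpoint len (s : seq T) : nat :=
  match s with
  | x :: ((y :: _) as s') => dist x y + len s'
  | _ => 0
  end.

Fixpoint consec_distinct (s : seq T) : bool :=
  match s with
  | x :: ((y :: _) as s') => (x != y) && consec_distinct s'
  | _ => true
  end.

Definition inI (l : nat) (s : seq T) : bool := consec_distinct s && (len s == l).

Definition del_at (i : nat) (s : seq T) : seq T := take i s ++ drop i.+1 s.

Local Open Scope ring_scope.

Definition inMC (k l : nat) (c : k.+1.-tuple T -> int) : Prop :=
  forall x, c x != 0 -> inI l x.

(* The differential MC_{k,l} -> MC_{k-1,l} applied to c : (k+1)-tuples -> Z,
   giving a function on k-tuples:
   d = sum_{i=1}^{k-1} (-1)^i d_i. For k = 0 the sum is empty (zero map). *)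
Definition bd (k : nat) (c : k.+1.-tuple T -> int) (y : k.-tuple T) : int :=
  \sum_(x : k.+1.-tuple T)
     \sum_(i < k.+1 | (0 < i)%N && (i < k)%N)
        (if (del_at i x == y :> seq T) && (len (del_at i x) == len x)
         then (-1) ^+ i * c x else 0).

Definition MH_vanishes (k l : nat) : Prop :=
  forall c : k.+1.-tuple T -> int, inMC l c ->
    (forall y, bd c y = 0) ->
    exists b : k.+2.-tuple T -> int, inMC l b /\ (forall x, c x = bd b x).

Definition diagonal : Prop := forall k l : nat, k <> l -> MH_vanishes k l.

End Graphs.

(* Main.v *)
(** Discrete Morse theory, with a matching read off from left to right. By
pawfulness, if [d p a <= 1] and [d a b = 2] there is a vertex [mid p a b]
adjacent to [a] and [b] and at distance at most [1] from [p]. Scan a generator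
[(x_0, ..., x_k)] with [x_{-1} := x_0], and stop at the first [i] such that
either [d x_i x_{i+1} = 2], or [x_{i+1}] can be deleted and equals
[mid x_{i-1} x_i x_{i+2}]. In the first case match the tuple with the one
obtained by inserting [mid x_{i-1} x_i x_{i+1}], in the second with the one
obtained by deleting [x_{i+1}]. As [d x_{i-1} (mid x_{i-1} x_i x_{i+1}) <= 1],
an insertion never creates an earlier stop, so this is an involution; the
unmatched tuples have all steps equal to [1], i.e. [k = l]. Acyclicity: give
each position the status 0 (not deletable), 1 (deletable and equal to the
chosen middle) or 2 (deletable otherwise); the vector of statuses of the longer
tuple decreases lexicographically along gradient paths. Hence the incidence
matrix between matched tuples is unitriangular, so one subtracts a boundary to
clear the insertion part of a cycle off the diagonal, and a cycle without
insertion part vanishes. *)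

Require Import Defs.
From mathcomp Require Import all_boot all_order all_algebra.
From mathcomp Require Import zify.
Set Implicit Arguments. Unset Strict Implicit. Unset Printing Implicit Defensive.
Import GRing.Theory.

(** * Distances and middle vertices in a pawful graph *)

Section Distance.
Variables (T : finType) (e : rel T).
Hypothesis pawful_e : pawful e.

Lemma dist_eq0 x y : (dist e x y == 0) = (x == y).
Proof.
have T_gt0 : 0 < #|T| by apply/card_gt0P; exists x.
rewrite /dist -(prednK T_gt0) /=.
have -> : walk_of_len e x y 0 = (x == y); last by case: (x == y).
apply/existsP/idP => [[p]|/eqP->]; first by rewrite [p]tuple0 /=.
by exists [tuple] => /=.
Qed.

Lemma walk_of_len_sym x y n : walk_of_len e x y n -> walk_of_len e y x n.
Proof.
have [[e_sym _] _] := pawful_e.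
case/existsP=> p /andP[e_p /eqP p_y]; apply/existsP.
have sz : size (rev (belast x p)) == n by rewrite size_rev size_belast size_tuple.
exists (Tuple sz) => /=; rewrite -p_y rev_path.
rewrite (eq_path (e' := e)) ?e_p; last by move=> u v /=; rewrite e_sym.
by case: (tval p) => //= z q; rewrite rev_cons last_rcons eqxx.
Qed.

Lemma distC x y : dist e x y = dist e y x.
Proof.
by apply: eq_find => n; apply/idP/idP; apply: walk_of_len_sym.
Qed.

Lemma dist_le2 x y : dist e x y <= 2.
Proof. by have [_ []] := pawful_e. Qed.

Lemma dist_edge x y : e x y -> dist e x y = 1.
Proof.
have [[_ [e_irr _]] _] := pawful_e => e_xy.
have x_y : x != y by apply: contraTneq e_xy => ->; rewrite e_irr.
have T_gt1 : 1 < #|T|.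
  by have := max_card (mem [set x; y]); rewrite cards2 x_y.
have w1 : walk_of_len e x y 1.
  by apply/existsP; exists [tuple y] => /=; rewrite e_xy eqxx.
have := dist_eq0 x y; rewrite (negbTE x_y) /dist.
by case: #|T| T_gt1 => [|[|n]] //= _; rewrite w1; case: ifP.
Qed.

Lemma walk_dist x y : walk_of_len e x y (dist e x y).
Proof.
have [[_ [_ e_conn]] _] := pawful_e.
have has_w : has (walk_of_len e x y) (iota 0 #|T|).
  have /connectP[p0 e_p0 y_p0] := e_conn x y.
  case/shortenP: e_p0 y_p0 => p e_p uniq_p _ y_p.
  apply/hasP; exists (size p).
    by rewrite mem_iota add0n /= -[(size p).+1]/(size (x :: p)) -(card_uniqP uniq_p) max_card.
  by apply/existsP; exists (in_tuple p); rewrite /= e_p y_p eqxx.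
have := nth_find 0 has_w; rewrite nth_iota //.
by rewrite -[X in _ < X](size_iota 0) -has_find.
Qed.

Lemma dist2_midpoint a b :
  dist e a b = 2 -> exists2 m, dist e a m = 1 & dist e m b = 1.
Proof.
move=> ab; have := walk_dist a b; rewrite ab => /existsP[[[|m [|b' []]] //= _]].
case/andP=> /and3P[e_am e_mb _] /eqP b'b; rewrite {}b'b in e_mb.
by exists m; apply: dist_edge.
Qed.

(* Falls back to the junk value [a] outside the hypotheses of [midP]. *)
Definition mid p a b : T :=
  odflt a [pick x | [&& dist e p x <= 1, dist e a x == 1 & dist e x b == 1]].

(** If [p = a], any midpoint of [a] and [b] serves. If [dist e p a = 1], pawfulness gives the vertex
    when [dist e p b = 2], and [p] itself serves when [dist e p b = 1]. *)
Lemma midP p a b : dist e p a <= 1 -> dist e a b = 2 ->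
  [/\ dist e p (mid p a b) <= 1, dist e a (mid p a b) = 1
    & dist e (mid p a b) b = 1].
Proof.
move=> pa ab; rewrite /mid; case: pickP => [x /and3P[? /eqP ? /eqP ?] //|/= no_mid].
suff [x [px ax xb]] : exists x, [/\ dist e p x <= 1, dist e a x = 1 & dist e x b = 1].
  by have := no_mid x; rewrite px ax xb.
have [/eqP|pa_neq0] := eqVneq (dist e p a) 0.
  rewrite dist_eq0 => /eqP->; have [m am mb] := dist2_midpoint ab.
  by exists m; rewrite am.
have {pa_neq0}pa : dist e p a = 1 by lia.
have := dist_le2 p b; rewrite leq_eqVlt => /orP[/eqP pb|].
  have [_ [_ paw]] := pawful_e.
  have ba : dist e b a = 2 by rewrite distC.
  have [x [xp xb xa]] := paw _ _ _ pb ba pa.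
  by exists x; rewrite distC xp distC xa.
rewrite ltnS leq_eqVlt => /orP[/eqP pb|].
  by exists p; rewrite (eqP (_ : dist e p p == 0)) ?dist_eq0 // distC.
by rewrite ltnS leqn0 dist_eq0 => /eqP p_b; move: pa; rewrite distC p_b ab.
Qed.

End Distance.

(** * The matching on tuples and its acyclicity *)

Section Matching.
Variables (T : finType) (e : rel T).
Hypothesis pawful_e : pawful e.
Local Notation d := (dist e).
Local Notation mid := (mid e).

(* In the functions below [p :: a :: s] is the scanned tuple, with [p] and [a]
   already passed; at the start of the scan [p = a]. [status p a s] concerns the
   head of [s]. *)
Definition status p a s : nat :=
  if s is b :: c :: _ then
    if [&& d a b == 1, d b c == 1 & d a c == 2] then
      if b == mid p a c then 1 else 2
    else 0
  else 0.

Arguments status : simpl never.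

Lemma statusE p a b c s : status p a [:: b, c & s] =
  if [&& d a b == 1, d b c == 1 & d a c == 2] then
    if b == mid p a c then 1 else 2
  else 0.
Proof. by []. Qed.

(** Insertion half of the matching; [down] is the deletion half. [None] means no stop, or a stop of
    the opposite kind. *)
Fixpoint up p a s : option (seq T) :=
  if s is b :: s' then
    if d a b == 2 then Some (mid p a b :: s)
    else if status p a s == 1 then None else omap (cons b) (up a b s')
  else None.

Fixpoint down p a s : option (seq T) :=
  if s is b :: s' then
    if d a b == 2 then None
    else if status p a s == 1 then Some s' else omap (cons b) (down a b s')
  else None.

(* [face a s t]: the tuple [a :: t] occurs in the boundary of [a :: s]. *)
Inductive face : T -> seq T -> seq T -> Prop :=
| face_here a b c s of d a b = 1 & d b c = 1 & d a c = 2 :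
    face a (b :: c :: s) (c :: s)
| face_later a b s t of face b s t : face a (b :: s) (b :: t).

(* The statuses as digits in base 3: a numerical form of the lexicographic order. *)
Fixpoint mu p a s : nat :=
  if s is b :: s' then status p a s * 3 ^ size s' + mu a b s' else 0.

Lemma status_le2 p a s : status p a s <= 2.
Proof. by case: s => [|b [|c s]]; rewrite /status //=; do ?case: ifP. Qed.

(** Base-3 digits are at most 2, so a drop in the leading digit outweighs all later ones. *)
Lemma mu_lt p a s : mu p a s < 3 ^ size s.
Proof.
elim: s p a => [|b s IH] p a //=; have := IH a b.
have := leq_mul (status_le2 p a (b :: s)) (leqnn (3 ^ size s)).
rewrite expnS; lia.
Qed.

Lemma status0 p a b c s : d a c <= 1 -> status p a [:: b, c & s] = 0.
Proof. by rewrite statusE => ac; case: ifP => // /and3P[_ _ /eqP ac2]; rewrite ac2 in ac. Qed.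

Lemma dist_le1 a b : d a b != 2 -> d a b <= 1.
Proof. by have := dist_le2 pawful_e a b; lia. Qed.

(* In the first case the new second vertex of [b :: t] is within distance [1] of
   [a], so [b] becomes non-deletable; in the second the status of [b] is kept. *)
Lemma up_head a b s t : d a b <= 1 -> up a b s = Some t ->
  exists c r, s = c :: r /\
   (d b c = 2 /\ t = [:: mid a b c, c & r] /\ d a (mid a b c) <= 1
   \/ d b c != 2 /\ exists r', t = c :: r').
Proof.
case: s => [|c r] //= ab; case: eqVneq => [bc [<-]|bc].
  by exists c, r; split=> //; left; case: (midP pawful_e ab bc).
case: ifP => // _; case: (up b c r) => //= r' [<-].
by exists c, r; split=> //; right; split=> //; exists r'.
Qed.

Lemma up_down p a s t : d p a <= 1 -> up p a s = Some t -> down p a t = Some s.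
Proof.
elim: s p a t => [|b s IH] p a t //= pa.
case: eqVneq => [ab [<-]|ab].
  have [pm am mb] := midP pawful_e pa ab.
  by rewrite /= statusE am mb ab !eqxx.
case: ifP => // bad; case up_s: (up a b s) => [s'|] //= [<-] /=.
have le_ab := dist_le1 ab.
rewrite (negbTE ab) (IH a b) //=.
suff -> : (status p a (b :: s') == 1) = false by [].
have [c [r [s_c [[bc [-> am]]|[bc [r' s'_c]]]]]] := up_head le_ab up_s.
  by rewrite status0.
by move: bad; rewrite s_c s'_c !statusE.
Qed.

Lemma down_up p a s t : down p a t = Some s -> up p a s = Some t.
Proof.
elim: t p a s => [|b t IH] p a s //=; case: eqVneq => // ab.
case: ifP => [|bad].
  case: t {IH} => [|c t] //; rewrite statusE; case: ifP => // /and3P[_ bc ac].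
  by case: (eqVneq b) => // -> _ [<-] /=; rewrite ac.
case down_t: (down a b t) => [s'|] //= [<-] /=; rewrite (negbTE ab) (IH _ _ _ down_t) /=.
(* If the vertex right after [b] is deleted, the new step from [b] has length 2 and [b] is not
   deletable; otherwise the status of [b] is unchanged. *)
suff -> : (status p a (b :: s') == 1) = false by [].
case: t down_t bad {IH} => [|c t] //=; case: ifP => // bc.
case: ifP => [good [<-]|_]; last by case: (down b c t) => //= ? [<-]; rewrite !statusE.
case: t good => [|c' t] //; rewrite statusE; case: ifP => // /and3P[_ _ /eqP bc'] _ _.
by rewrite statusE bc' andbF.
Qed.

Lemma size_down p a s t : down p a s = Some t -> size s = (size t).+1.
Proof.
elim: s p a t => [|b s IH] p a t //=; case: ifP => // _.
case: ifP => [_ [->] //|_]; case down_s: (down _ _ _) => [s'|] //= [<-] /=.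
by rewrite (IH _ _ _ down_s).
Qed.

Lemma down_face p a s t : down p a s = Some t -> face a s t.
Proof.
elim: s p a t => [|b s IH] p a t //=; case: ifP => // _; case: ifP => [|_].
  case: s {IH} => [|c s] //; rewrite statusE.
  by case: ifP => // /and3P[/eqP ab /eqP bc /eqP ac] _ [<-]; constructor.
case down_s: (down _ _ _) => [s'|] //= [<-].
by apply: face_later; apply: IH down_s.
Qed.

Lemma size_face a s t : face a s t -> size s = (size t).+1.
Proof. by elim=> //= {}a {}b {}s {}t _ ->. Qed.

Lemma face_cons a b s t : face a (b :: s) t ->
  (exists c r, [/\ s = c :: r, t = s, d a b = 1, d b c = 1 & d a c = 2])
  \/ (exists2 t', t = b :: t' & face b s t').
Proof.
move=> f; inversion f as [a' b' c r ab bc ac|a' b' s' t' f']; subst.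
  by left; exists c, r.
by right; exists t'.
Qed.

(** One gradient step from [x] to [y]: the leftmost status that changes drops. *)
Lemma mu_face p a s t x y : d p a <= 1 -> up p a s = Some x -> face a x t ->
  t <> s -> up p a t = Some y -> mu p a y < mu p a x.
Proof.
move=> pa /(up_down pa); elim: x p a s t y pa => [|b x IH] p a s t y pa //=.
case: ifP => // /negbT ab down_x face_t t_s up_t.
have le_ab := dist_le1 ab.
have size_y : size y = (size x).+1.
  by have /size_down -> := up_down pa up_t; rewrite -(size_face face_t).
have small y' : y = b :: y' -> status p a y = 0 -> mu p a y < 3 ^ size x.
  move=> y_b; move: size_y; rewrite y_b => -[<-] /= ->.
  by rewrite mul0n add0n mu_lt.
move: down_x; case: ifP => [/eqP good [x_s]|bad].
  case/face_cons: face_t => [[c [r [_ t_x _ _ _]]]|[t' t_b f]].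
    by rewrite t_x x_s in t_s.
  (* Here [b] is the inserted middle. As [up] does not stop at [b] in [t], the face deleted the
     vertex after [b]; the new insertion there turns the status of [b] from 1 to 0. *)
  move: good; rewrite t_b /= (negbTE ab) in up_t *.
  case: ifP up_t => // bad; case up_t': (up a b t') => [y'|] //= [y_b].
  case: x f x_s {IH size_y} small => [|c x] f x_s small good; first by inversion f.
  rewrite good mul1n ltn_addr //; apply: (small y') => //; rewrite -y_b.
  case/face_cons: f => [[c' [r [x_c t'_x _ _ bc']]]|[t'' t'_c _]].
    move: up_t'; rewrite t'_x x_c /= bc' eqxx => -[<-].
    by rewrite status0 //; case: (midP pawful_e le_ab bc').
  by move: bad; rewrite t'_c -[status _ _ _]/(status p a [:: b, c & x]) good.
case down_x: (down a b x) => [s'|] //= [s_b].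
case/face_cons: face_t => [[c [r [x_c t_x ab1 bc ac]]]|[t' t_b f]].
  (* The deleted [b] was not the chosen middle, which now replaces it: the digit drops from 2 to
     1. *)
  move: up_t; rewrite t_x x_c /= ac eqxx => -[y_c].
  have [pm am mc] := midP pawful_e pa ac.
  move: bad; rewrite x_c -y_c /= !statusE ab1 bc ac am mc !eqxx /=.
  case: ifP => // _ _; apply: leq_trans (leq_addr _ _).
  by rewrite (mulSn 1) !mul1n ltn_add2l; apply: (mu_lt a (mid p a c) (c :: r)).
move: up_t; rewrite t_b /= (negbTE ab).
case: ifP => // bad'; case up_t': (up a b t') => [y'|] //= [y_b].
have lt_y' : mu a b y' < mu a b x.
  apply: IH down_x f _ up_t' => // t'_s'; apply: t_s.
  by rewrite t_b t'_s'.
(* The tail decreases, so it suffices that the status of [b] does not grow: it becomes 0 or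
   stays. *)
suff le_st : status p a y <= status p a (b :: x).
  move: size_y; rewrite -y_b /= => -[->]; rewrite -y_b in le_st.
  by rewrite -addnS leq_add // leq_mul2r le_st orbT.
have [c [r [t'_c [[bc [y'_m am]]|[bc [r' y'_c]]]]]] := up_head le_ab up_t'.
  by rewrite -y_b y'_m status0.
case: x f {IH down_x bad size_y small lt_y'} => [|c' x] f; first by inversion f.
case/face_cons: f => [[c'' [r'' [x_c t'_x _ _ bc'']]]|[t'' t'_c' _]].
  by move: t'_c bc; rewrite t'_x x_c => -[<- _]; rewrite bc''.
by move: t'_c; rewrite t'_c' -y_b y'_c => -[-> _].
Qed.

Lemma unmatched p a s : consec_distinct (a :: s) -> up p a s = None ->
  down p a s = None -> len e (a :: s) = size s.
Proof.
elim: s p a => [|b s IH] p a //=; case: ifP => // ab /andP[a_b cd]; case: ifP => // _.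
case up_s: (up a b s) => //; case down_s: (down a b s) => // _ _.
rewrite -/(len e (b :: s)) (IH _ _ cd up_s down_s).
have := dist_eq0 e a b; rewrite (negbTE a_b); have := dist_le2 pawful_e a b; lia.
Qed.

End Matching.

Local Open Scope ring_scope.

(** * Linear algebra of a matrix unitriangular along a matching *)

Section Triangular.
Variables (R : comNzRingType) (X Y : finType).
Variables (D : X -> Y -> R) (M : Y -> X -> bool) (mu : X -> nat).
Hypothesis M_fun : forall s x y, M s x -> M s y -> x = y.
Hypothesis M_unit : forall s x, M s x -> D x s * D x s = 1.
Hypothesis M_descent : forall s x t y, M s x -> M t y -> D x t != 0 -> t != s ->
  (mu y < mu x)%N.

(** Solved from the largest [mu] down: [n] bounds the [mu] of the equations still open. *)
Lemma triangular_surj (c : Y -> R) : exists b : X -> R,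
  (forall x, b x != 0 -> exists s, M s x) /\
  (forall s x, M s x -> \sum_y D y s * b y = c s).
Proof.
suff main n : (forall s x, M s x -> (n <= mu x)%N -> c s = 0) ->
  exists b : X -> R, (forall x, b x != 0 -> exists s, M s x) /\
  (forall s x, M s x -> \sum_y D y s * b y = c s).
  apply: (main (\max_x mu x).+1) => s x _.
  by rewrite leqNgt ltnS (leq_bigmax x).
elim: n c => [|n IH] c c0.
  exists (fun=> 0); split=> [x|s x Msx]; first by rewrite eqxx.
  by rewrite (c0 s x) // big1 // => y _; rewrite mulr0.
(* Solves level [n] exactly, each diagonal entry being its own inverse; by descent the higher levels
   are untouched. *)
pose b1 x := \sum_(s | M s x && (mu x == n)) D x s * c s.
have b1E t y : M t y -> (n <= mu y)%N ->
    \sum_x D x t * b1 x = if mu y == n then c t else 0.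
  move=> Mty n_le; rewrite (bigD1 y) //= big1 ?addr0 => [|x x_y].
    rewrite /b1; case: eqP => [mu_y|_]; last first.
      by rewrite big_pred0 ?mulr0 // => s; rewrite andbF.
    rewrite (bigD1 t) /= ?Mty // mulrDr mulrA (M_unit Mty) mul1r mulr_sumr.
    rewrite big1 ?addr0 // => s /andP[/andP[Msy _] s_t].
    have [->|D0] := eqVneq (D y t) 0; first by rewrite mul0r.
    by have := M_descent Msy Mty D0; rewrite eq_sym s_t ltnn => /(_ isT).
  rewrite mulr_sumr big1 // => s /andP[Msx /eqP mu_x].
  have [->|D0] := eqVneq (D x t) 0; first by rewrite mul0r.
  have t_s : t != s by apply: contraNneq x_y => t_s; rewrite (M_fun Msx (y := y)) // -t_s.
  by have := M_descent Msx Mty D0 t_s; rewrite mu_x ltnNge n_le.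
have [s x Msx n_le|b [b_supp bE]] := IH (fun s => c s - \sum_x D x s * b1 x).
  rewrite (b1E _ _ Msx n_le); case: eqP => [_|/eqP mu_x]; first by rewrite subrr.
  by rewrite (c0 s x) ?subrr // ltn_neqAle eq_sym mu_x.
exists (fun x => b x + b1 x); split=> [x|s x Msx].
  have [-> b1x|/b_supp //] := eqVneq (b x) 0; rewrite add0r in b1x.
  have [s /andP[Msx _]|no_s] := pickP (fun s => M s x && (mu x == n)); first by exists s.
  by rewrite /b1 big_pred0 ?eqxx in b1x.
under eq_bigr => y _ do rewrite mulrDr.
by rewrite big_split /= (bE _ _ Msx) subrK.
Qed.

(** At [x] of maximal [mu] in the support, the equation of its partner keeps only the diagonal term:
    any other contributor would have larger [mu]. *)
Lemma triangular_inj (z : X -> R) : (forall x, z x != 0 -> exists s, M s x) ->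
  (forall s, \sum_x D x s * z x = 0) -> forall x, z x = 0.
Proof.
move=> z_supp dz x0; apply/eqP; apply/negP => /negP z_x0.
case: (@arg_maxnP _ x0 (fun x => z x != 0) mu z_x0) => x z_x x_max.
have [s Msx] := z_supp x z_x.
have := dz s; rewrite (bigD1 x) //= big1 ?addr0 => [Dz0|y y_x].
  by case/eqP: z_x; rewrite -[z x]mul1r -(M_unit Msx) -mulrA Dz0 mulr0.
have [->|z_y] := eqVneq (z y) 0; first by rewrite mulr0.
have [->|D0] := eqVneq (D y s) 0; first by rewrite mul0r.
have [t Mty] := z_supp y z_y.
have s_t : s != t by apply: contraNneq y_x => s_t; rewrite (M_fun Mty (y := x)) // -s_t.
by have := M_descent Mty Msx D0 s_t; rewrite ltnNge [(_ <= _)%N](x_max y z_y).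
Qed.

End Triangular.

(** * The differential as an incidence matrix *)

Section Incidence.
Variables (T : finType) (e : rel T).
Hypothesis pawful_e : pawful e.
Local Notation d := (dist e).

Definition incidence (x y : seq T) : int :=
  \sum_(1 <= i < (size x).-1)
    if (del_at i x == y) && (len e (del_at i x) == len e x) then (-1) ^+ i else 0.

Lemma bdE k (c : k.+1.-tuple T -> int) (y : k.-tuple T) :
  bd e c y = \sum_(x : k.+1.-tuple T) incidence x y * c x.
Proof.
apply: eq_bigr => x _; rewrite /incidence size_tuple /= mulr_suml.
rewrite -(big_mkord (fun i => (0 < i)%N && (i < k)%N)
  (fun i => if (del_at i x == y :> seq T) && (len e (del_at i x) == len e x)
            then (-1) ^+ i * c x else 0)).
rewrite [RHS]big_nat_cond big_mkcond [RHS]big_mkcond /=.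
case: k c x y => [|k] c x y; first by rewrite big_nat1 big_geq.
rewrite big_ltn //= add0r big_nat_recr //= ltnn addr0.
by apply: eq_big_nat => i /andP[-> ->] /=; case: ifP => // _; rewrite mul0r.
Qed.

Lemma size_del_at i (s : seq T) : (i < size s)%N -> size (del_at i s) = (size s).-1.
Proof. by move=> i_lt; rewrite size_cat size_take size_drop i_lt; lia. Qed.

Lemma del_at_cons i a (s : seq T) : del_at i.+1 (a :: s) = a :: del_at i s.
Proof. by []. Qed.

Lemma del_at0 a (s : seq T) : del_at 0 (a :: s) = s.
Proof. by rewrite /del_at /= drop0. Qed.

Lemma del_at_del_at i j (s : seq T) : (j < i)%N ->
  del_at j (del_at i s) = del_at i.-1 (del_at j s).
Proof.
elim: s i j => [|a s IH] [|i] [|j] //= ji; rewrite ?del_at_cons ?del_at0 //.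
by rewrite IH //; case: i ji.
Qed.

Lemma dist_triangle a b c : (d a c <= d a b + d b c)%N.
Proof.
have := dist_le2 pawful_e a c.
have := dist_eq0 e a b; have := dist_eq0 e b c.
case: (eqVneq a b) => [->|_] bc ab; first by rewrite leq_addl.
case: (eqVneq b c) bc => [<-|_] bc; first by rewrite leq_addr.
lia.
Qed.

Lemma len_cons2 a b s : len e [:: a, b & s] = (d a b + len e (b :: s))%N.
Proof. by []. Qed.

Lemma len_del_at i a s : (len e (a :: del_at i s) <= len e (a :: s))%N.
Proof.
elim: s i a => [|b s IH] [|i] a //.
  rewrite del_at0; case: s {IH} => [|c s] //; rewrite !len_cons2 addnA leq_add2r.
  exact: dist_triangle.
by rewrite del_at_cons !len_cons2 leq_add2l.
Qed.

(** Two positive distances with sum [d a c <= 2] are both 1, the shape required by [face_here]. *)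
Lemma del_at_face i a s : consec_distinct (a :: s) -> (i.+1 < size s)%N ->
  len e (a :: del_at i s) = len e (a :: s) -> face e a s (del_at i s).
Proof.
elim: i a s => [|i IH] a [|b [|c s]] //; last first.
  move=> /andP[_ cd] lt; rewrite del_at_cons !(len_cons2 a b) => /addnI eq_len.
  by apply: face_later; apply: IH.
case/and3P=> a_b b_c _ _; rewrite del_at0 !len_cons2 addnA => /addIn eq_d.
have := dist_eq0 e a b; have := dist_eq0 e b c; rewrite (negbTE a_b) (negbTE b_c).
by have := dist_le2 pawful_e a c; constructor; lia.
Qed.

Lemma face_del_at a s t : face e a s t -> exists i,
  [/\ (i.+1 < size s)%N, t = del_at i s & len e (a :: t) = len e (a :: s)].
Proof.
elim=> {a s t} [a b c s ab bc ac|a b s t _ [i [lt -> eq_len]]].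
  by exists 0%N; rewrite del_at0 !len_cons2 ab bc ac.
by exists i.+1; rewrite del_at_cons !(len_cons2 a) eq_len.
Qed.

(** At position [i] the two results hold consecutive entries of [s], which differ. Hence no two
    terms of an incidence can cancel. *)
Lemma del_at_neq i j (s : seq T) : consec_distinct s -> (i < j < size s)%N ->
  del_at i s != del_at j s.
Proof.
elim: i j s => [|i IH] [|j] [|a s] cd lt; do ?[by move: lt => /=; lia].
  case: s cd lt => [|b s] /=; first by lia.
  rewrite del_at0 del_at_cons => /andP[a_b _] _.
  by apply: contraNneq a_b => -[-> _].
rewrite !del_at_cons eqseq_cons eqxx; apply: IH => //.
by case: s cd lt => // b s /andP[].
Qed.

Lemma face_consec a s t :
  face e a s t -> consec_distinct (a :: s) = consec_distinct (a :: t).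
Proof.
elim=> {a s t} [a b c s ab bc ac|a b s t _ IH]; last first.
  by rewrite /= -/(consec_distinct (b :: s)) IH.
by rewrite /= -!(dist_eq0 e) ab bc ac.
Qed.

Lemma face_inI l a s t : face e a s t -> inI e l (a :: s) = inI e l (a :: t).
Proof.
move=> f; rewrite /inI (face_consec f).
by have [i [_ _ ->]] := face_del_at f.
Qed.

Lemma incidence_face a s y : consec_distinct (a :: s) -> incidence (a :: s) y != 0 ->
  exists2 t, y = a :: t & face e a s t.
Proof.
move=> cd inc_n0; have /hasP[i] : has (fun i => (del_at i (a :: s) == y) &&
    (len e (del_at i (a :: s)) == len e (a :: s))) (index_iota 1 (size s)).
  apply: contraNT inc_n0 => /hasPn no_i; rewrite /incidence big_seq big1 // => i i_in.
  by rewrite (negbTE (no_i i i_in)).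
rewrite mem_index_iota => /andP[]; case: i => // i _ lt /andP[/eqP <- /eqP eq_len].
by exists (del_at i s) => //; apply: del_at_face.
Qed.

Lemma incidence_unit a s t : consec_distinct (a :: s) -> face e a s t ->
  incidence (a :: s) (a :: t) * incidence (a :: s) (a :: t) = 1.
Proof.
move=> cd /face_del_at[i [lt -> eq_len]].
rewrite /incidence (bigD1_seq i.+1) ?iota_uniq ?mem_index_iota ?lt //.
rewrite big_seq_cond big1 => [|j /andP[]].
  by rewrite del_at_cons eqxx eq_len eqxx /= addr0 -expr2 sqrr_sign.
rewrite mem_index_iota => /andP[j_gt0 j_lt] j_i; case: ifP => // /andP[/eqP del_j _].
have [lt_ji|lt_ij|/eqP] := ltngtP j i.+1; last by rewrite (negbTE j_i).
  by have := @del_at_neq j i.+1 (a :: s) cd; rewrite lt_ji /= del_j eqxx ltnS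
    (ltnW lt) => /(_ isT).
by have := @del_at_neq i.+1 j (a :: s) cd; rewrite lt_ij /= del_j eqxx ltnS
  (ltnW j_lt) => /(_ isT).
Qed.

(** Induction peels off the last row and column, where [G k j] cancels [G j k.-1]. *)
Lemma alternating_sum_eq0 k (G : nat -> nat -> int) :
  (forall i j, (0 < j < i)%N -> (i <= k)%N -> G i j = - G j i.-1) ->
  \sum_(1 <= i < k.+1) \sum_(1 <= j < k) G i j = 0.
Proof.
elim: k => [|[|k] IH] GN; first by rewrite big_geq.
  by rewrite big_nat1 big_geq.
rewrite big_nat_recr //=; under eq_bigr => i _ do rewrite big_nat_recr //=.
rewrite big_split /= IH ?add0r => [|i j ji ik]; last by rewrite GN // ltnW.
rewrite -big_split /= big_nat big1 // => j /andP[j_gt0 j_lt].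
by rewrite (GN k.+2) ?j_gt0 ?subrr //= addrN.
Qed.

Lemma incidence_sqr k (x : k.+2.-tuple T) (z : seq T) :
  \sum_(y : k.+1.-tuple T) incidence x y * incidence y z = 0.
Proof.
pose G i j : int := if (del_at j (del_at i x) == z) &&
  (len e (del_at j (del_at i x)) == len e x) then (-1) ^+ (i + j) else 0.
transitivity (\sum_(1 <= i < k.+1) \sum_(1 <= j < k) G i j); last first.
  apply: alternating_sum_eq0 => i j /andP[j_gt0 ji] ik.
  rewrite /G (del_at_del_at _ ji); case: ifP; rewrite ?oppr0 // => _.
  by rewrite -[i in LHS](ltn_predK ji) addSn exprS mulN1r addnC.
under eq_bigr => y _ do rewrite {1}/incidence size_tuple mulr_suml.
rewrite exchange_big; apply: eq_big_nat => i /andP[i_gt0 ik] /=.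
have sz : size (del_at i x) == k.+1 by rewrite size_del_at size_tuple // ltnW.
rewrite (bigD1 (Tuple sz)) //= [X in _ + X]big1 ?addr0 => [|y y_x]; last first.
  case: eqP => [eq_y|_]; last by rewrite /= mul0r.
  by case/eqP: y_x; apply: val_inj; rewrite /= eq_y.
rewrite eqxx /incidence (eqP sz) /= mulr_sumr; apply: eq_big_nat => j /andP[j_gt0 jk].
(* Deletions never lengthen, so a double deletion preserves [len] exactly when both single ones
   do. *)
have lens : (len e (del_at j (del_at i x)) <= len e (del_at i x) <= len e x)%N.
  case: i i_gt0 ik sz {G} => // i _ _ _; case: j j_gt0 jk => // j _ _.
  by case: (tval x) => // a s; rewrite !del_at_cons !len_del_at.
rewrite /G; case: eqP => eq_i.
  by rewrite eq_i; case: ifP; rewrite ?mulr0 // exprD.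
rewrite mul0r [_ == len e x]eqn_leq; case: ifP => // /andP[_] le_x.
by case/andP: lens => ? ?; case: eq_i; apply/eqP; rewrite eqn_leq; lia.
Qed.

Lemma bd_bd k (b : k.+2.-tuple T -> int) (z : k.-tuple T) : bd e (bd e b) z = 0.
Proof.
rewrite bdE; under eq_bigr => y _ do rewrite bdE mulr_sumr.
rewrite exchange_big big1 //= => x _.
under eq_bigr => y _ do rewrite mulrCA mulrA.
by rewrite -mulr_suml incidence_sqr mul0r.
Qed.

(** * The matching on generators *)

Definition matched l (s x : seq T) : bool :=
  match s, x with
  | a :: s', b :: x' => [&& inI e l x, b == a & up e a a s' == Some x']
  | _, _ => false
  end.

Definition measure (x : seq T) : nat := if x is a :: x' then mu e a a x' else 0.

Lemma matchedP l s x : matched l s x -> exists a s' x',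
  [/\ s = a :: s', x = a :: x', inI e l x & up e a a s' = Some x'].
Proof.
case: s x => [|a s'] [|b x'] //= /and3P[+ /eqP b_a /eqP up_s].
by rewrite b_a => x_l; exists a, s', x'.
Qed.

Lemma dist_self_le1 a : (d a a <= 1)%N.
Proof. by have := dist_eq0 e a a; rewrite eqxx => /eqP->. Qed.

Lemma up_face a s x : up e a a s = Some x -> face e a x s.
Proof. by move/(up_down pawful_e (dist_self_le1 a))/down_face. Qed.

Lemma inI_consec l s : inI e l s -> consec_distinct s.
Proof. by case/andP. Qed.

Lemma matched_fun l s x y : matched l s x -> matched l s y -> x = y.
Proof.
move=> /matchedP[a [s' [x' [-> -> _ up_x]]]] /matchedP[_ [_ [y' [[<- <-] -> _]]]].
by rewrite up_x => -[->].
Qed.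

Lemma matched_unit l s x : matched l s x -> incidence x s * incidence x s = 1.
Proof.
case/matchedP=> a [s' [x' [-> -> /inI_consec cd /up_face f]]].
exact: incidence_unit.
Qed.

Lemma matched_descent l s x t y : matched l s x -> matched l t y ->
  incidence x t != 0 -> t != s -> (measure y < measure x)%N.
Proof.
case/matchedP=> a [s' [x' [-> -> /inI_consec cd up_s]]].
case/matchedP=> b [t' [y' [-> -> _ up_t]]] /(incidence_face cd)[_ [ba <-] f].
rewrite {}ba in up_t * => t_s.
apply: (mu_face pawful_e (dist_self_le1 a) up_s f _ up_t) => t's.
by rewrite t's eqxx in t_s.
Qed.

(** A scan without a stop makes [len] equal the number of steps, which [size s != l.+1] excludes. *)
Lemma matched_cover l s : inI e l s -> size s != l.+1 -> s != [::] ->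
  (exists x, matched l s x /\ size x = (size s).+1) \/
  (exists t, matched l t s /\ size s = (size t).+1).
Proof.
case: s => // a s s_l size_s _; case up_s: (up e a a s) => [x|].
  have f := up_face up_s; left; exists (a :: x).
  by rewrite /= eqxx up_s eqxx (face_inI l f) s_l (size_face f).
case down_s: (down e a a s) => [t|].
  right; exists (a :: t); rewrite /= s_l eqxx (down_up down_s) eqxx.
  by rewrite (size_down down_s).
have /andP[cd /eqP len_s] := s_l.
by move: size_s; rewrite /= -(unmatched pawful_e cd up_s down_s) len_s eqxx.
Qed.

Lemma bd_inMC k l (b : k.+2.-tuple T -> int) : inMC e l b -> inMC e l (bd e b).
Proof.
move=> b_l y; rewrite bdE => sum_n0.
have [x] : exists x : k.+2.-tuple T, incidence x y * b x != 0.
  apply/existsP; apply: contraNT sum_n0; rewrite negb_exists => /forallP all0.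
  by rewrite big1 // => x _; apply/eqP; rewrite -[_ == _]negbK all0.
rewrite mulf_eq0 negb_or => /andP[xy /b_l x_l]; move: x_l xy.
case: (tval x) => [|a s] s_l; first by rewrite /incidence big_geq ?eqxx.
by case/(incidence_face (inI_consec s_l))=> t -> /face_inI <-.
Qed.

End Incidence.

(** * Vanishing off the diagonal *)

Theorem theorem3p3 (T : finType) (e : rel T) :
  pawful e -> diagonal e.
Proof.
move=> pawful_e k l k_l c c_l dc.
have M_fun n (s : n.-tuple T) (x y : n.+1.-tuple T) :
    matched e l s x -> matched e l s y -> x = y.
  by move=> Msx Msy; apply: val_inj; apply: matched_fun Msx Msy.
have M_unit n (s : n.-tuple T) (x : n.+1.-tuple T) :
    matched e l s x -> incidence e x s * incidence e x s = 1.
  exact: matched_unit.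
have M_descent n (s : n.-tuple T) (x : n.+1.-tuple T) (t : n.-tuple T)
    (y : n.+1.-tuple T) :
    matched e l s x -> matched e l t y -> incidence e x t != 0 -> t != s ->
    (measure e y < measure e x)%N.
  by rewrite -(inj_eq val_inj); apply: matched_descent.
(* The boundary of [b] agrees with [c] on every tuple matched by insertion. *)
have [b [b_supp db]] := triangular_surj (M_fun _) (M_unit _) (M_descent _) c.
have b_l : inMC e l b.
  by move=> x /b_supp[s /matchedP[a [s' [x' []]]]].
exists b; split=> // x; apply/eqP; rewrite -subr_eq0; apply/eqP; move: x.
(* The difference of [c] and [bd e b] is a cycle supported on tuples matched by deletion. *)
apply: (triangular_inj (M_fun _) (M_unit _) (M_descent _)) => [x z_x|s].
  have x_l : inI e l x.
    have [c_x|/c_l //] := eqVneq (c x) 0.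
    by apply: (bd_inMC pawful_e b_l); move: z_x; rewrite c_x add0r oppr_eq0.
  have [||[y [Mxy size_y]]|[t [Mtx size_t]]] := matched_cover pawful_e x_l.
  - by rewrite size_tuple eqSS; apply/eqP.
  - by rewrite -size_eq0 size_tuple.
  - have sz : size y == k.+2 by rewrite size_y size_tuple.
    by move: z_x; rewrite bdE (db x (Tuple sz)) // subrr eqxx.
  - have sz : size t == k by rewrite -eqSS -size_t size_tuple.
    by exists (Tuple sz).
have : bd e c s - bd e (bd e b) s = 0 by rewrite dc bd_bd // subrr.
rewrite !(bdE e) -sumrB => eq0; rewrite -[RHS]eq0.
by apply: eq_bigr => x _; rewrite mulrBr.
Qed.
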